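(* Let $u\in\mathbb{N}$ and $q\in(1/u,1)$. If a permutation matrix $P$ satisfies $\mathrm{ex}(u,P) < q u^2$, then \[ c_P \le 2u^3\, u^{\lceil -\log u/\log q\rceil}. \]
   Context: A binary matrix has entries in $\{0,1\}$; a permutation matrix is a square binary matrix with exactly one $1$-entry in every row and every column. A binary matrix $A$ contains a binary matrix $B$ if $B$ can be obtained from $A$ by deleting some rows, some columns, and changing some $1$-entries to $0$-entries; otherwise $A$ avoids $B$. $\mathrm{ex}(n,P)$ is the maximum number of $1$-entries in an $n\times n$ binary matrix avoiding $P$. The Füredi--Hajnal limit is $c_P=\lim_{n\to\infty}\mathrm{ex}(n,P)/n$ (this limit exists and is finite). Logarithms are base $2$. *)

(* Defs.v *)
From mathcomp Require Import all_boot all_order all_algebra.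
From mathcomp Require Import all_classical all_reals all_analysis.
Set Implicit Arguments.
Unset Strict Implicit.
Unset Printing Implicit Defensive.
Import Order.TTheory GRing.Theory Num.Theory.
Import numFieldNormedType.Exports.
Local Open Scope classical_set_scope.
Local Open Scope ring_scope.

(* Binary matrices are matrices over bool, with true standing for 1. *)

Definition permutation_matrix (k : nat) (P : 'M[bool]_k) : bool :=
  [forall i : 'I_k, #|[pred j | P i j]| == 1%N] &&
  [forall j : 'I_k, #|[pred i | P i j]| == 1%N].

Definition increasing (p m : nat) (f : {ffun 'I_p -> 'I_m}) : bool :=
  [forall i : 'I_p, forall j : 'I_p, (i < j)%N ==> (f i < f j)%N].

(* Deleting rows and columns of A amounts to keeping those listed, in order,
   by f and g; changing 1s to 0s amounts to going down entrywise. *)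
Definition contains (m n p q : nat) (A : 'M[bool]_(m, n))
    (B : 'M[bool]_(p, q)) : bool :=
  [exists f : {ffun 'I_p -> 'I_m}, exists g : {ffun 'I_q -> 'I_n},
    [&& increasing f, increasing g &
      [forall i : 'I_p, forall j : 'I_q, B i j ==> mxsub f g A i j]]].

Definition avoids (m n p q : nat) (A : 'M[bool]_(m, n))
    (B : 'M[bool]_(p, q)) : bool := ~~ contains A B.

Definition num_ones (m n : nat) (A : 'M[bool]_(m, n)) : nat :=
  #|[pred ij : 'I_m * 'I_n | A ij.1 ij.2]|.

(* If P has a 1-entry, the zero matrix avoids P and the maximum is over a
   nonempty set; a maximum over the empty set is 0. *)
Definition ex (n p q : nat) (P : 'M[bool]_(p, q)) : nat :=
  \max_(A : 'M[bool]_n | avoids A P) num_ones A.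

(* limn is total; for a permutation matrix P this sequence does converge in R,
   by superadditivity of ex (Fekete) and the Marcus-Tardos theorem. *)
Definition FurediHajnal_limit (R : realType) (k : nat) (P : 'M[bool]_k) : R :=
  limn (fun n : nat => (ex n P)%:R / n%:R : R).

Definition log2 (R : realType) (x : R) : R := ln x / ln 2.

(* Main.v *)
(* Let h+1 be the ceiling of -log u / log q, so that u q^(h+1) <= 1. The key fact
   is that a matrix with u^2 columns and u^(h+1) rows, each with at least u ones,
   contains P: otherwise, merging consecutive rows in a u-ary tree and discarding
   columns would give a u x u matrix of density at least q avoiding P.

   Cut an (n u^2) x (n u^2) matrix avoiding P into blocks of side u^2. The
   pattern of nonempty blocks avoids P, and so does the matrix obtained from the
   wide blocks (those with at least u nonempty columns) of a block column by
   merging the rows of each of them; hence there are at most u^(h+1) wide blocks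
   in every block column, and likewise tall blocks in every block row. Thus
     ex (n u^2) <= (u-1)^2 ex n + 2 n u^(h+1) u^4,
   which yields ex n <= 2 u^3 u^(h+1) n for every power n of u^2. *)
Require Import Defs.
From mathcomp Require Import all_boot all_order all_algebra.
From mathcomp Require Import all_classical all_reals all_analysis.
From mathcomp Require Import zify ring lra.
Import Order.TTheory GRing.Theory Num.Theory.
Import numFieldNormedType.Exports.
Local Open Scope classical_set_scope.
Local Open Scope ring_scope.

(** * Permutation patterns in infinite binary matrices *)

(** The pattern is the permutation matrix with its 1-entries at [(i, s i)]. Taking [A] over all of
    [nat] lets submatrices and merged rows be formed without tracking dimensions. *)
Definition occurs (k : nat) (s : 'I_k -> 'I_k) (A : rel nat) : Prop :=
  exists f g : 'I_k -> nat,
    [/\ {homo f : i j / (i < j)%N}, {homo g : i j / (i < j)%N}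
      & forall i, A (f i) (g (s i))].

Definition count_ones (A : rel nat) (m n : nat) : nat :=
  (\sum_(x < m) \sum_(y < n) A x y)%N.

Lemma sum_blocks (n t : nat) (F : nat -> nat) :
  (\sum_(x < n * t) F x = \sum_(i < n) \sum_(x < t) F (i * t + x))%N.
Proof.
elim: n => [|n IHn]; first by rewrite mul0n !big_ord0.
rewrite big_ord_recr /= -IHn -!(big_mkord xpredT F) mulSn addnC.
rewrite (big_cat_nat (n := (n * t)%N)) ?leq_addr //=; congr addn.
rewrite -{1}[(n * t)%N]add0n big_addn addKn big_mkord.
by apply: eq_bigr => i _; rewrite addnC.
Qed.

Lemma sorted_nth_ltn (D : seq nat) (x y : nat) :
  sorted ltn D -> (x < y < size D)%N -> (nth 0 D x < nth 0 D y)%N.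
Proof.
move=> sD /andP[xy yD].
by rewrite (sorted_ltn_nth ltn_trans) // inE (ltn_trans xy).
Qed.

Lemma sum_pred_count (T : Type) (p : pred T) (D : seq T) :
  (\sum_(y <- D) p y = count p D)%N.
Proof.
by rewrite -sum1_count [RHS]big_mkcond; apply: eq_bigr => y _; case: (p y).
Qed.

Section Occurrences.
Variables (k : nat) (s s' : 'I_k -> 'I_k).
Hypotheses (sK : cancel s s') (s'K : cancel s' s).

(* As [s] is a bijection, the entries of [A] chosen below the different entries
   of an occurrence in [B] lie in distinct rows and columns, and can therefore
   be chosen independently. *)
Lemma occurs_trans (A B : rel nat) (rho gamma : nat -> nat -> Prop) :
  (forall x z x' z', rho x x' -> rho z z' -> (x < z)%N -> (x' < z')%N) ->
  (forall y z y' z', gamma y y' -> gamma z z' -> (y < z)%N -> (y' < z')%N) ->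
  (forall x y, B x y -> exists x' y', [/\ rho x x', gamma y y' & A x' y']) ->
  occurs _ s B -> occurs _ s A.
Proof.
move=> rhoP gammaP BA [f [g [f_lt g_lt fgB]]].
have /fin_all_exists2 [h hP hA] : forall i, exists2 z : nat * nat,
    rho (f i) z.1 /\ gamma (g (s i)) z.2 & A z.1 z.2.
  by move=> i; have [x' [y' [? ? ?]]] := BA _ _ (fgB i); exists (x', y').
exists (fun i => (h i).1), (fun j => (h (s' j)).2); split=> [i j ij|i j ij|i].
- by apply: rhoP (f_lt _ _ ij); [case: (hP i) | case: (hP j)].
- apply: gammaP (g_lt _ _ ij).
    by have [_] := hP (s' i); rewrite s'K.
  by have [_] := hP (s' j); rewrite s'K.
- by rewrite sK.
Qed.

Lemma occurs_transpose (A : rel nat) :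
  occurs _ s' (fun x y => A y x) -> occurs _ s A.
Proof.
move=> [f [g [f_lt g_lt fgA]]]; exists g, f; split=> // i.
by have := fgA (s i); rewrite sK.
Qed.

End Occurrences.

(** * Density increments and wide blocks *)

Section WideBlocks.
Variables (R : realFieldType) (k : nat) (s s' : 'I_k -> 'I_k).
Hypotheses (sK : cancel s s') (s'K : cancel s' s).
Variables (u : nat) (q : R).
Hypothesis dense_occurs :
  forall A : rel nat, q * u%:R ^+ 2 <= (count_ones A u u)%:R -> occurs _ s A.

(* Discarding a column with the fewest ones does not decrease the density, so
   one may assume that there are exactly [u] columns. *)
Lemma dense_columns_occurs (A : rel nat) (D : seq nat) :
  sorted ltn D -> (u <= size D)%N ->
  q * u%:R * (size D)%:R <= (\sum_(y <- D) \sum_(x < u) A x y)%N%:R ->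
  occurs _ s A.
Proof.
have [n] := ubnP (size D); elim: n D => // n IHn D; rewrite ltnS => Dn sD uD dD.
have [Du|Du] := eqVneq (size D) u.
  (* The columns listed in [D] are renumbered from 0; the guard excludes the default value of
     [nth]. *)
  pose B x y := (y < u)%N && A x (nth 0 D y).
  have : occurs _ s B.
    apply: dense_occurs; move: dD; rewrite Du -mulrA -expr2; congr (_ <= _%:R).
    rewrite (big_nth 0) Du big_mkord exchange_big; apply: eq_bigr => x _.
    by apply: eq_bigr => y _; rewrite /B ltn_ord.
  apply: (@occurs_trans _ _ _ sK s'K _ _ eq
    (fun y y' => (y < u)%N /\ y' = nth 0 D y)).
  - by move=> x z _ _ <- <-.
  - move=> y z _ _ [yu ->] [zu ->] yz; apply: sorted_nth_ltn => //.
    by rewrite yz Du.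
  - by move=> x y /andP[yu ?]; exists x, (nth 0 D y).
pose w y := (\sum_(x < u) A x y)%N.
have {}uD : (u < size D)%N by rewrite ltn_neqAle eq_sym Du.
have [y yD y_min] : exists2 y, y \in D & forall z, z \in D -> (w y <= w z)%N.
  have x0 : 'I_(size D) by apply: Ordinal (leq_ltn_trans (leq0n u) uD).
  have [i _ i_min] := @arg_minnP _ x0 xpredT (fun i => w (nth 0 D i)) isT.
  exists (nth 0 D i); first exact: mem_nth.
  move=> z zD; have zi : (index z D < size D)%N by rewrite index_mem.
  by have := i_min (Ordinal zi) isT; rewrite /= nth_index.
have D_uniq : uniq D := sorted_uniq ltn_trans ltnn sD.
apply: (IHn (rem y D)).
- by rewrite size_rem // prednK //; apply: leq_ltn_trans uD.
- exact: (subseq_sorted ltn_trans (rem_subseq y D)).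
- by rewrite size_rem // -ltnS prednK //; apply: leq_ltn_trans uD.
have w_avg : (size D * w y <= \sum_(z <- D) w z)%N.
  rewrite (big_nth 0) big_mkord -[X in (X * _)%N]card_ord -sum_nat_const.
  by apply: leq_sum => i _; apply: y_min; apply: mem_nth.
have Dw : (\sum_(z <- D) w z = w y + \sum_(z <- rem y D) w z)%N.
  by rewrite (perm_big _ (perm_to_rem yD)) big_cons.
rewrite -/(w _) in dD *; rewrite size_rem //.
move: w_avg dD; rewrite Dw -!/(w _).
set W := (\sum_(z <- rem y D) _)%N => w_avg dD.
have D1 : (1 <= size D)%N by apply: leq_ltn_trans uD.
move: w_avg dD D1; case: (size D) => // d w_avg dD _ /=.
have [d0|d0] := posnP d; first by rewrite d0 mulr0 ler0n.
have {}w_avg : d%:R * (w y)%:R <= W%:R :> R by rewrite -natrM ler_nat; lia.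
have d1 : 0 < d.+1%:R :> R by rewrite ltr0n.
(* With [w] the minimum and [W] the rest, [d w <= W] and [q u (d+1) <= w + W] give
   [d q u (d+1) <= d w + d W <= (d+1) W]. *)
rewrite -(ler_pM2l d1).
rewrite natrD in dD.
have : d%:R * (q * u%:R * d.+1%:R) <= d%:R * ((w y)%:R + W%:R) :> R.
  by rewrite ler_wpM2l ?ler0n.
by rewrite -[d.+1]addn1 natrD; nra.
Qed.

(* Arrange the rows as the leaves of a u-ary tree. The root sees at most |D|
   nonempty columns and a leaf at least [u]. Since [|D| q^(i+1) <= u], the
   number of nonempty columns cannot drop by more than a factor [q] at each step
   towards a leaf, so some node keeps at least a fraction [q] of its nonempty
   columns in every child; merge the rows of each child. *)
Lemma tall_occurs (i : nat) (A : rel nat) (D : seq nat) :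
  (0 < u)%N -> 0 <= q -> sorted ltn D -> (size D)%:R * q ^+ i.+1 <= u%:R ->
  (forall x, (x < u ^ i.+1)%N -> (u <= count (A x) D)%N) ->
  occurs _ s A.
Proof.
move=> u_gt0 q_ge0; elim: i A D => [|i IHi] A D sD Dq Au.
  apply: (@dense_columns_occurs A D) => //.
    by apply: leq_trans (Au 0 _) (count_size _ _); rewrite expn1.
  rewrite mulrAC [_ * u%:R]mulrC [q * _]mulrC -[q]expr1.
  (* Each of the [u] rows has at least [u] ones, and [|D| q <= u]. *)
  apply: (@le_trans _ _ (u%:R * u%:R)); first by rewrite ler_wpM2l ?ler0n.
  rewrite -natrM ler_nat exchange_big /= -[leqLHS]/(u * u)%N.
  rewrite -{1}[u]card_ord -sum_nat_const; apply: leq_sum => x _.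
  by rewrite sum_pred_count // Au // expn1.
set m := (u ^ i.+1)%N in Au *.
have m_gt0 : (0 < m)%N by rewrite expn_gt0 u_gt0.
pose B c y := [exists x : 'I_m, A (c * m + x)%N y].
have inm (c : 'I_u) x : (x < m)%N -> (c * m + x < u ^ i.+2)%N.
  move=> xm; rewrite expnS -/m.
  apply: (@leq_trans (c.+1 * m)); first by rewrite mulSn addnC ltn_add2r.
  by rewrite leq_mul2r ltn_ord orbT.
have [/existsP[c cD]|/existsPn Dc] :=
  boolP [exists c : 'I_u, (count (B c) D)%:R < q * (size D)%:R].
  have : occurs _ s (fun x y => (x < m)%N && A (c * m + x)%N y).
    apply: (IHi _ [seq y <- D | B c y]).
    - exact: (sorted_filter ltn_trans).
    - rewrite size_filter; apply: le_trans Dq.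
      rewrite [q ^+ i.+2]exprS mulrA; apply: ler_wpM2r; first exact: exprn_ge0.
      by rewrite mulrC ltW.
    - move=> x xm; apply: leq_trans (Au _ (inm c x xm)) _.
      rewrite count_filter; apply: sub_count => y /= Ay; rewrite xm Ay /=.
      by apply/existsP; exists (Ordinal xm).
  apply: (@occurs_trans _ _ _ sK s'K _ _ (fun x x' => x' = c * m + x)%N eq).
  - by move=> x z _ _ -> ->; rewrite ltn_add2l.
  - by move=> y z _ _ <- <-.
  - by move=> x y /andP[_ ?]; exists (c * m + x)%N, y.
have : occurs _ s B.
  apply: (@dense_columns_occurs _ D) => //.
    by apply: leq_trans (Au 0 _) (count_size _ _); rewrite expn_gt0 u_gt0.
  rewrite exchange_big /= natr_sum mulrAC mulr_natr -[X in _ *+ X]card_ord.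
  rewrite -sumr_const; apply: ler_sum => c _.
  by rewrite sum_pred_count leNgt Dc.
(* Rows with different quotients by [m] are ordered like these quotients, so any choice of one row
   per group is monotone. *)
apply: (@occurs_trans _ _ _ sK s'K _ _ (fun x x' => x' %/ m = x)%N eq).
- move=> _ _ x z <- <-; apply: contraTT; rewrite -!leqNgt.
  by move=> zx; apply: leq_div2r.
- by move=> y z _ _ <- <-.
- move=> x y /existsP[z Az]; exists (x * m + z)%N, y; split=> //.
  by rewrite divnMDl // divn_small // addn0.
Qed.

(** Tall blocks of [A] are the wide blocks of its transpose, with [i] and [j] exchanged. *)
Definition wide (A : rel nat) (t i j : nat) : bool :=
  (u <= count (fun y => [exists x : 'I_t, A (i * t + x)%N (j * t + y)%N])
              (iota 0 t))%N.

Lemma count_wide (A : rel nat) (t h n j : nat) :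
  (0 < u)%N -> 0 <= q -> t%:R * q ^+ h.+1 <= u%:R -> ~ occurs _ s A ->
  (\sum_(i < n) wide A t i j <= u ^ h.+1)%N.
Proof.
move=> u_gt0 q_ge0 tq nA; rewrite leqNgt; apply/negP => W_big; apply: nA.
pose W := [seq i <- iota 0 n | wide A t i j].
have sW : sorted ltn W by apply: (sorted_filter ltn_trans); apply: iota_ltn_sorted.
have W_size : (u ^ h.+1 < size W)%N.
  rewrite size_filter -sum_pred_count.
  by move: W_big; rewrite -(big_mkord xpredT (fun i => wide A t i j : nat)) /index_iota subn0.
(* Row [a] merges the rows of the [a]-th wide block; beyond [size W], the default value of [nth]
   would point to block 0. *)
pose B a y := (a < size W)%N &&
  [exists x : 'I_t, A (nth 0 W a * t + x)%N (j * t + y)%N].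
have : occurs _ s B.
  apply: (@tall_occurs h _ (iota 0 t)) => //.
  - exact: iota_ltn_sorted.
  - by rewrite size_iota.
  - move=> a ah; have aW : (a < size W)%N := ltn_trans ah W_size.
    have : nth 0 W a \in W by apply: mem_nth.
    rewrite mem_filter => /andP[wa _]; apply: leq_trans wa _.
    by apply: sub_count => y /=; rewrite /B aW.
apply: (@occurs_trans _ _ _ sK s'K _ _
  (fun a x' => (a < size W)%N /\ x' %/ t = nth 0 W a)%N
  (fun y y' => y' = j * t + y)%N).
- move=> a b x z [aW xa] [bW zb] ab.
  have : (x %/ t < z %/ t)%N.
    by rewrite xa zb; apply: sorted_nth_ltn; rewrite // ab.
  by apply: contraTT; rewrite -!leqNgt => zx; apply: leq_div2r.
- by move=> y z _ _ -> ->; rewrite ltn_add2l.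
- move=> a y /andP[aW /existsP[x Ax]].
  exists (nth 0 W a * t + x)%N, (j * t + y)%N; split=> //; split=> //.
  have t_gt0 : (0 < t)%N by apply: leq_ltn_trans (ltn_ord x).
  by rewrite divnMDl // divn_small // addn0.
Qed.

End WideBlocks.

(** * The recursive inequality *)

(* The blocks have side [u^2]. Each of them is empty, wide, tall, or has fewer
   than [u] nonempty rows and fewer than [u] nonempty columns. *)
Lemma count_ones_blocks (R : realFieldType) (k : nat) (s s' : 'I_k -> 'I_k)
    (u h n E : nat) (q : R) (A : rel nat) :
  cancel s s' -> cancel s' s -> (0 < u)%N -> 0 <= q -> u%:R * q ^+ h.+1 <= 1 ->
  (forall B : rel nat, q * u%:R ^+ 2 <= (count_ones B u u)%:R -> occurs _ s B) ->
  (forall B : rel nat, ~ occurs _ s B -> (count_ones B n n <= E)%N) ->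
  ~ occurs _ s A ->
  (count_ones A (n * u ^ 2) (n * u ^ 2) <=
     E * u.-1 ^ 2 + 2 * (n * u ^ h.+1 * u ^ 4))%N.
Proof.
move=> sK s'K u_gt0 q_ge0 uq dense E_max nA.
set t := (u ^ 2)%N; pose A' x y := A y x.
have nA' : ~ occurs _ s' A'.
  by move=> oA'; apply: nA; apply: (@occurs_transpose _ _ s').
have dense' B : q * u%:R ^+ 2 <= (count_ones B u u)%:R -> occurs _ s' B.
  move=> uB; apply: (@occurs_transpose _ _ s) => //; apply: dense.
  by rewrite /count_ones exchange_big.
have tq : t%:R * q ^+ h.+1 <= u%:R.
  rewrite natrX expr2 -mulrA -[leRHS]mulr1.
  by apply: ler_wpM2l.
pose col i j y := [exists x : 'I_t, A (i * t + x)%N (j * t + y)%N].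
pose row i j x := [exists y : 'I_t, A (i * t + x)%N (j * t + y)%N].
pose block i j := (\sum_(x < t) \sum_(y < t) A (i * t + x) (j * t + y))%N.
pose B i j := [exists x : 'I_t, exists y : 'I_t, A (i * t + x)%N (j * t + y)%N].
have count_blocks : count_ones A (n * t) (n * t) =
    (\sum_(i < n) \sum_(j < n) block i j)%N.
  rewrite /count_ones (sum_blocks _ _ (fun x => \sum_(y < n * t) A x y)%N).
  apply: eq_bigr => i _.
  under eq_bigr => x _ do rewrite (sum_blocks _ _ (fun y => A (i * t + x)%N y)).
  by rewrite exchange_big.
have nB : ~ occurs _ s B.
  apply: contra_not nA; apply: (@occurs_trans _ _ _ sK s'K _ _
    (fun x x' => x' %/ t = x)%N (fun y y' => y' %/ t = y)%N).
  - move=> _ _ x z <- <-; apply: contraTT; rewrite -!leqNgt.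
    by move=> zx; apply: leq_div2r.
  - move=> _ _ x z <- <-; apply: contraTT; rewrite -!leqNgt.
    by move=> zx; apply: leq_div2r.
  - move=> i j /existsP[x /existsP[y Axy]].
    have t_gt0 : (0 < t)%N by rewrite expn_gt0 u_gt0.
    exists (i * t + x)%N, (j * t + y)%N.
    by split; rewrite // divnMDl // divn_small // addn0.
have block_le i j : (block i j <=
    B i j * u.-1 ^ 2 + (wide u A t i j + wide u A' t j i) * u ^ 4)%N.
  (* Every 1-entry of the block lies where a nonempty row meets a nonempty column. *)
  have rc : (block i j <=
      count (row i j) (iota 0 t) * count (col i j) (iota 0 t))%N.
    rewrite -!sum_pred_count -{1 2}[t]subn0 -/(index_iota 0 t) !big_mkord.
    rewrite big_distrl; apply: leq_sum => x _; rewrite big_distrr.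
    apply: leq_sum => y _ /=; case: (boolP (A _ _)) => // Axy.
    have -> : row i j x by apply/existsP; exists y.
    by have -> : col i j y by apply/existsP; exists x.
  have t2 : (t * t = u ^ 4)%N by rewrite -expnD.
  have big_block : (block i j <= u ^ 4)%N.
    apply: leq_trans rc _; rewrite -t2.
    by apply: leq_mul; apply: leq_trans (count_size _ _) _; rewrite size_iota.
  have [wA|wA] := boolP (wide u A t i j).
    by apply: leq_trans big_block _; rewrite mulnDl mul1n; lia.
  have [wA'|wA'] := boolP (wide u A' t j i).
    by apply: leq_trans big_block _; rewrite mul1n; lia.
  have [Bij|/existsPn nBij] := boolP (B i j); last first.
    rewrite leqn0 /block big1 // => x _; rewrite big1 // => y _.
    by have /existsPn/(_ y)/negbTE -> := nBij x.
  rewrite mul1n mul0n addn0; apply: leq_trans rc _.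
  by apply: leq_mul; rewrite -ltnS prednK // ltnNge.
rewrite count_blocks.
apply: (@leq_trans (\sum_(i < n) \sum_(j < n)
  (B i j * u.-1 ^ 2 + (wide u A t i j + wide u A' t j i) * u ^ 4))%N).
  by apply: leq_sum => i _; apply: leq_sum => j _.
under eq_bigr => i _ do rewrite big_split /= -!big_distrl /= big_split /=.
rewrite big_split /= -!big_distrl /= big_split /= -/(count_ones B n n).
apply: leq_add; first by rewrite leq_mul2r E_max ?orbT.
rewrite [(2 * _)%N]mulnA leq_mul2r mul2n -addnn; apply/orP; right.
(* Wide blocks are counted by block column, tall ones by block row. *)
rewrite exchange_big.
apply: leq_add; rewrite -[X in (_ <= X * _)%N]card_ord -sum_nat_const.
  by apply: leq_sum => j _; apply: (count_wide _ _ _ _ sK s'K u q).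
by apply: leq_sum => j _; apply: (count_wide _ _ _ _ s'K sK u q).
Qed.

(** * Translation between finite matrices and relations *)

Definition rel_of_mx (n : nat) (A : 'M[bool]_n) : rel nat :=
  fun x y => [exists i : 'I_n, exists j : 'I_n,
    [&& i == x :> nat, j == y :> nat & A i j]].

Lemma rel_of_mxE (n : nat) (A : 'M[bool]_n) (i j : 'I_n) :
  rel_of_mx n A i j = A i j.
Proof.
apply/existsP/idP => [[x /existsP[y]]|Aij].
  by move=> /and3P[/eqP/val_inj -> /eqP/val_inj ->].
by exists i; apply/existsP; exists j; rewrite !eqxx.
Qed.

Lemma num_ones_count (n : nat) (A : 'M[bool]_n) :
  num_ones A = count_ones (rel_of_mx n A) n n.
Proof.
rewrite /num_ones -sum1_card big_mkcond /count_ones pair_big /=.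
apply: eq_bigr => -[i j] _ /=; rewrite rel_of_mxE inE /=.
by case: (A i j).
Qed.

Section PermutationMatrix.
Variables (k : nat) (P : 'M[bool]_k) (s s' : 'I_k -> 'I_k).
Hypotheses (sK : cancel s s') (s'K : cancel s' s).
Hypothesis Ps : forall i j, P i j = (s i == j).

Lemma contains_occurs (n : nat) (A : rel nat) :
  contains (\matrix_(i < n, j < n) A i j) P -> occurs _ s A.
Proof.
case/existsP=> f /existsP[g /and3P[/forallP f_lt /forallP g_lt /forallP PA]].
exists (fun i => f i : nat), (fun j => g j : nat); split=> [i j ij|i j ij|i].
- by have /forallP/(_ j)/implyP/(_ ij) := f_lt i.
- by have /forallP/(_ j)/implyP/(_ ij) := g_lt i.
- by have /forallP/(_ (s i)) := PA i; rewrite Ps eqxx !mxE.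
Qed.

(** The column map sends [j] to the column of the entry chosen for row [s' j], the row of the only
    1-entry of [P] in column [j]. *)
Lemma occurs_contains (n : nat) (A : 'M[bool]_n) :
  occurs _ s (rel_of_mx n A) -> contains A P.
Proof.
move=> [f [g [f_lt g_lt fgA]]].
have /fin_all_exists2 [h hf hA] : forall i, exists2 z : 'I_n * 'I_n,
    (z.1 = f i :> nat) /\ (z.2 = g (s i) :> nat) & A z.1 z.2.
  move=> i; have /existsP[x /existsP[y /and3P[/eqP xf /eqP yg Axy]]] := fgA i.
  by exists (x, y).
apply/existsP; exists [ffun i => (h i).1].
apply/existsP; exists [ffun j => (h (s' j)).2].
apply/and3P; split; apply/forallP => i; apply/forallP => j; apply/implyP.
- by rewrite !ffunE (hf i).1 (hf j).1; apply: f_lt.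
- by rewrite !ffunE (hf _).2 (hf _).2 !s'K; apply: g_lt.
- by rewrite Ps => /eqP <-; rewrite !mxE !ffunE sK.
Qed.

Lemma count_ones_le_ex (n : nat) (A : rel nat) :
  ~ occurs _ s A -> (count_ones A n n <= ex n P)%N.
Proof.
move=> nA; pose M := \matrix_(i < n, j < n) A i j.
have -> : count_ones A n n = num_ones M.
  rewrite num_ones_count; apply: eq_bigr => i _; apply: eq_bigr => j _.
  by rewrite rel_of_mxE mxE.
by apply: leq_bigmax_cond; apply/negP => /contains_occurs.
Qed.

Lemma ex_le (n E : nat) :
  (forall A : rel nat, ~ occurs _ s A -> (count_ones A n n <= E)%N) ->
  (ex n P <= E)%N.
Proof.
move=> E_max; apply/bigmax_leqP => A /negP nA; rewrite num_ones_count.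
by apply: E_max => /occurs_contains.
Qed.

End PermutationMatrix.

Lemma permutation_matrix_bij (k : nat) (P : 'M[bool]_k) :
  permutation_matrix P -> exists s s' : 'I_k -> 'I_k,
    [/\ cancel s s', cancel s' s & forall i j, P i j = (s i == j)].
Proof.
case/andP=> /forallP Prow /forallP Pcol.
have /fin_all_exists [s sP] : forall i, exists j, P i =1 (fun j' => j' == j).
  by move=> i; have /card1P[j Pij] := Prow i; exists j => j'; apply: Pij.
have /fin_all_exists [s' s'P] :
    forall j, exists i, forall i', P i' j = (i' == i).
  by move=> j; have /card1P[i Pij] := Pcol j; exists i => i'; apply: Pij.
exists s, s'; split=> [i|j|i j]; last by rewrite sP eq_sym.
- by apply/eqP; rewrite eq_sym -s'P sP.
- by apply/eqP; rewrite eq_sym -sP s'P.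
Qed.

(** * Iteration along powers of [u ^ 2] and passage to the limit *)

(** The constant is preserved by the recursion: the additive term is [u] times the bound for [n],
    and [(u-1)^2 + u <= u^2]. *)
Lemma ex_pow_le (R : realFieldType) (k : nat) (P : 'M[bool]_k) (u h m : nat)
    (q : R) :
  permutation_matrix P -> (0 < u)%N -> 0 <= q -> u%:R * q ^+ h.+1 <= 1 ->
  (ex u P)%:R < q * u%:R ^+ 2 ->
  (ex ((u ^ 2) ^ m) P <= 2 * u ^ 3 * u ^ h.+1 * (u ^ 2) ^ m)%N.
Proof.
move=> /permutation_matrix_bij[s [s' [sK s'K Ps]]] u_gt0 q_ge0 uq ex_u.
have ex_max n B : ~ occurs _ s B -> (count_ones B n n <= ex n P)%N.
  exact: (count_ones_le_ex _ _ _ Ps).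
have dense B : q * u%:R ^+ 2 <= (count_ones B u u)%:R -> occurs _ s B.
  move=> uB; apply: contrapT => /(ex_max u); rewrite -(ler_nat R) leNgt.
  by rewrite (lt_le_trans ex_u).
have N_gt0 : (0 < u ^ h.+1)%N by rewrite expn_gt0 u_gt0.
elim: m => [|m IHm].
  rewrite expn0 muln1; apply: (@leq_trans 1); last first.
    by rewrite !muln_gt0 expn_gt0 u_gt0.
  apply: (ex_le _ _ _ _ sK s'K Ps) => A _.
  by rewrite /count_ones !big_ord1 leq_b1.
rewrite expnSr; set n := ((u ^ 2) ^ m)%N in IHm *.
apply: (ex_le _ _ _ _ sK s'K Ps) => A nA.
apply: leq_trans (count_ones_blocks _ _ _ _ _ _ _ _ _ _ sK s'K u_gt0 q_ge0 uq
  dense (ex_max n) nA) _.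
apply: (@leq_trans (2 * u ^ 3 * u ^ h.+1 * n * u.-1 ^ 2
                    + 2 * (n * u ^ h.+1 * u ^ 4))%N).
  by rewrite leq_add2r leq_mul2r IHm orbT.
have -> : (2 * u ^ 3 * u ^ h.+1 * n * u.-1 ^ 2 + 2 * (n * u ^ h.+1 * u ^ 4) =
           2 * u ^ 3 * u ^ h.+1 * n * (u.-1 ^ 2 + u))%N.
  by rewrite (expnSr u 3); ring.
rewrite [leqRHS]mulnA leq_mul2l; apply/orP; right.
by case: u u_gt0 {IHm n nA ex_u uq dense N_gt0} => // v _ /=; nia.
Qed.

(** The base of the logarithm cancels. As [ln q < 0 < ln u], the ratio is positive, hence so is its
    ceiling, and [ln u / - ln q <= h+1] exponentiates to the bound. *)
Lemma ceil_log_ratio (R : realType) (u : nat) (q : R) :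
  (0 < u)%N -> 1 / u%:R < q < 1 ->
  exists2 h : nat, Num.ceil (- log2 (u%:R : R) / log2 q) = h.+1%:Z
    & u%:R * q ^+ h.+1 <= 1.
Proof.
move=> u_gt0 /andP[uq q1].
have u1 : 1 < u%:R :> R.
  by move: (lt_trans uq q1); rewrite ltr_pdivrMr ?ltr0n // mul1r.
have u0 : 0 < u%:R :> R by apply: lt_trans u1.
have q0 : 0 < q by apply: lt_trans uq; rewrite divr_gt0.
have lnu : 0 < ln (u%:R : R) by rewrite ln_gt0.
have lnq : ln q < 0 by rewrite ln_lt0 // q0.
have ln2 : 0 < ln (2 : R) by rewrite ln_gt0 // ltr1n.
have -> : - log2 u%:R / log2 q = ln u%:R / - ln q :> R.
  by rewrite /log2; field; rewrite (lt0r_neq0 ln2) (ltr0_neq0 lnq).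
set x := _ / _.
have x0 : 0 < x by rewrite divr_gt0 // oppr_gt0.
have := ceil_ge x; case: (Num.ceil x) => [[|h]|h] xh.
- by have := lt_le_trans x0 xh; rewrite ltxx.
- exists h => //; rewrite -ler_ln ?posrE ?mulr_gt0 ?exprn_gt0 //.
  rewrite lnM ?posrE ?exprn_gt0 // lnXn // ln1 -[ln q *+ _]mulr_natr.
  by move: xh; rewrite ler_pdivrMr ?oppr_gt0 // -pmulrn; lra.
- have := lt_le_trans x0 xh; rewrite NegzE mulrNz oppr_gt0 -pmulrn ltNge.
  by rewrite ler0n.
Qed.

Theorem theorem1p5 (R : realType) (u : nat) (q : R) (k : nat) (P : 'M[bool]_k)
  (hu : (0 < u)%N)
  (hq : 1 / u%:R < q < 1)
  (hP : permutation_matrix P)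
  (hex : (ex u P)%:R < q * u%:R ^+ 2) :
  FurediHajnal_limit R P <=
    2 * u%:R ^+ 3 * u%:R ^ Num.ceil (- log2 u%:R / log2 q).
Proof.
have [h -> uq] := ceil_log_ratio _ _ _ hu hq.
have /andP[q_gt q1] := hq.
have u0 : 0 < u%:R :> R by rewrite ltr0n.
have q0 : 0 <= q by apply/ltW/(lt_trans _ q_gt); rewrite divr_gt0.
(* The interval for [q] forces [u > 1], so the powers of [u ^ 2] are unbounded. *)
have u2 : (1 < u ^ 2)%N.
  have : 1 / u%:R < 1 :> R := lt_trans q_gt q1.
  by rewrite ltr_pdivrMr // mul1r ltr1n -(ltn_exp2r 1 u (isT : 0 < 2)%N).
rewrite -exprnP /FurediHajnal_limit.
set C := (X in _ <= X); set c := fun n : nat => _.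
(* If the sequence diverged, its [limn] would be the default value [0]. *)
have [c_cvg|/dvgP ->] := pselect (cvgn c); last first.
  by rewrite -[point]/(0 : R) !mulr_ge0 ?exprn_ge0 ?ler0n.
(* A limit above [C] would put all late terms above [C], including one at a power of [u ^ 2]. *)
rewrite leNgt; apply/negP => /(cvgr_gt _ c_cvg)[n0 _ n0P].
set n := ((u ^ 2) ^ n0)%N.
have n_ge : (n0 <= n)%N := ltnW (ltn_expl _ u2).
have n_gt0 : 0 < n%:R :> R by rewrite ltr0n expn_gt0 ltnW.
suff : c n <= C by apply/negP; rewrite -ltNge; apply: n0P.
rewrite /c ler_pdivrMr // /C -!natrX -!natrM ler_nat.
exact: (ex_pow_le _ _ _ _ _ _ _ hP hu q0 uq hex).
Qed.
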